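(* Let $f(z)=\sum_{k=0}^\infty a_k z^k$, with $a_k>0$ for all $k\ge 0$, be an entire function, and for $n\ge 2$ put $q_n(f)=\frac{a_{n-1}^2}{a_{n-2}a_n}$. Suppose that $q_2(f)\leq q_3(f)$. If $f$ belongs to the Laguerre-Pólya class, then there exists a real number $z_0\in\left[-\frac{a_1}{a_2},0\right]$ such that $f(z_0)\leq 0$.
   Context: A real entire function $f$ belongs to the Laguerre-Pólya class ($f\in\mathcal{L-P}$) if it can be expressed in the form $f(x)=c x^n e^{-\alpha x^2+\beta x}\prod_{k=1}^\infty\left(1-\frac{x}{x_k}\right)e^{x x_k^{-1}}$, where $c,\alpha,\beta,x_k\in\mathbb{R}$, $x_k\neq 0$, $\alpha\ge 0$, $n$ is a nonnegative integer and $\sum_{k=1}^\infty x_k^{-2}<\infty$; the product may be finite or empty (in the latter case it equals $1$). *)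

(* Defs.v *)
From Stdlib Require Export Reals.
From Coquelicot Require Export Coquelicot.

Open Scope R_scope.

(* Coquelicot has no complex exponential: exp (x + i y) = e^x (cos y + i sin y). *)
Definition Cexp (z : C) : C :=
  (exp (Re z) * cos (Im z), exp (Re z) * sin (Im z)).

Definition entire (f : C -> C) : Prop :=
  forall z : C, ex_derive (K := C_AbsRing) (V := C_NormedModule) f z.

Definition real_entire (f : C -> C) : Prop :=
  entire f /\ forall x : R, Im (f (RtoC x)) = 0.

(* prod_{k < m} (1 - z / x_k) e^{z / x_k}; the zeros are indexed from 0. *)
Fixpoint canonical_partial_product (x : nat -> R) (m : nat) (z : C) : C :=
  match m with
  | O => 1%C
  | S m' => (canonical_partial_product x m' z
             * ((1 - z / RtoC (x m')) * Cexp (z * / RtoC (x m'))))%C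
  end.

(* The product is either finite (empty if m = 0) or infinite.  In the infinite
   case square-summability of 1 / x_k already forces convergence of the product,
   so pointwise convergence of the partial products identifies P. *)
Definition canonical_product (P : C -> C) : Prop :=
  (exists (m : nat) (x : nat -> R),
     (forall k : nat, (k < m)%nat -> x k <> 0) /\
     forall z : C, P z = canonical_partial_product x m z) \/
  (exists x : nat -> R,
     (forall k : nat, x k <> 0) /\
     ex_series (fun k : nat => / (x k) ^ 2) /\
     forall z : C,
       filterlim (fun m : nat => canonical_partial_product x m z)
         eventually (locally (P z))).

Definition laguerre_polya (f : C -> C) : Prop :=
  real_entire f /\
  exists (c alpha beta : R) (n : nat) (P : C -> C),
    0 <= alpha /\
    canonical_product P /\
    forall z : C,
      f z = (RtoC c * z ^ n
             * Cexp (- RtoC alpha * z ^ 2 + RtoC beta * z) * P z)%C.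

(* q_n(f) for f = sum_k a_k z^k; used only for n >= 2. *)
Definition second_quotient (a : nat -> R) (n : nat) : R :=
  (a (n - 1)%nat) ^ 2 / (a (n - 2)%nat * a n).

(* Main.v *)
Require Import Defs.
From Stdlib Require Import Lra Lia Psatz.

(* Suppose f > 0 on [-a1/a2, 0], and put A_i = a_i / a_0 and y_k = -1/x_k.
   As f > 0 on [0, oo), all y_k >= 0, and letting x -> +oo in f(x) >= a_0 forces
   alpha = 0 and S_1 <= beta, where S_j = sum_k y_k^j.  Comparing the expansions
   of ln f at 0+ gives beta = A_1, S_2 = A_1^2 - 2 A_2 and
   S_3 = A_1^3 - 3 A_1 A_2 + 3 A_3.  Cauchy-Schwarz S_2^2 <= S_1 S_3 together
   with q_2 <= q_3 yields 3 A_2 <= A_1^2, whereas y_k < A_2 / A_1 for all k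
   yields S_2 < A_2, that is A_1^2 < 3 A_2. *)

(** * Elementary logarithm inequalities *)

Lemma ln_1p_bounds (t : R) : 0 <= t ->
  t - t ^ 2 / 2 + t ^ 3 / 3 - t ^ 4 / 4 <= ln (1 + t)
  <= t - t ^ 2 / 2 + t ^ 3 / 3.
Proof.
  intros Ht.
  (* Both bounds are sign statements for a difference that vanishes at 0; the derivatives of the two
     differences are s^4 / (1 + s) and s^3 / (1 + s). *)
  assert (mono : forall g dg : R -> R, g 0 = 0 ->
    (forall s, 0 <= s -> is_derive g s (dg s)) ->
    (forall s, 0 <= s -> 0 <= dg s) -> 0 <= g t).
  { intros g dg g0 Hd Hp.
    destruct (MVT_gen g 0 t dg) as [c [Hc E]].
    - intros s Hs; apply Hd; rewrite Rmin_left in Hs; lra.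
    - intros s Hs; apply derivable_continuous_pt.
      exists (dg s); apply is_derive_Reals, Hd.
      rewrite Rmin_left in Hs; lra.
    - rewrite Rmin_left, Rmax_right in Hc by lra.
      specialize (Hp c (proj1 Hc)); nra. }
  split.
  - enough (0 <= ln (1 + t) - (t - t ^ 2 / 2 + t ^ 3 / 3 - t ^ 4 / 4)) by lra.
    apply (mono (fun s => ln (1 + s) - (s - s ^ 2 / 2 + s ^ 3 / 3 - s ^ 4 / 4))
                (fun s => s ^ 4 / (1 + s))).
    + rewrite Rplus_0_r, ln_1; field.
    + intros s Hs; auto_derive; [lra | field; lra].
    + intros s Hs; apply Rdiv_le_0_compat; [apply pow_le; lra | lra].
  - enough (0 <= (t - t ^ 2 / 2 + t ^ 3 / 3) - ln (1 + t)) by lra.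
    apply (mono (fun s => (s - s ^ 2 / 2 + s ^ 3 / 3) - ln (1 + s))
                (fun s => s ^ 3 / (1 + s))).
    + rewrite Rplus_0_r, ln_1; field.
    + intros s Hs; auto_derive; [lra | field; lra].
    + intros s Hs; apply Rdiv_le_0_compat; [apply pow_le; lra | lra].
Qed.

Lemma ln_le_minus_1 (u : R) : 0 < u -> ln u <= u - 1.
Proof.
  intros Hu; generalize (exp_ineq1_le (ln u)); rewrite exp_ln; lra.
Qed.

(** * O(1) as x -> 0+, modelled by boundedness on (0, 1], and cubic expansions *)

Definition bounded01 (g : R -> R) : Prop :=
  exists M : R, forall x : R, 0 < x <= 1 -> Rabs (g x) <= M.

Lemma bounded01_const (c : R) : bounded01 (fun _ => c).
Proof. exists (Rabs c); intros; lra. Qed.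

Lemma bounded01_id : bounded01 (fun x => x).
Proof. exists 1; intros; rewrite Rabs_pos_eq; lra. Qed.

Lemma bounded01_plus (g h : R -> R) :
  bounded01 g -> bounded01 h -> bounded01 (fun x => g x + h x).
Proof.
  intros [M HM] [N HN]; exists (M + N); intros x Hx.
  generalize (HM x Hx) (HN x Hx) (Rabs_triang (g x) (h x)); lra.
Qed.

Lemma bounded01_mult (g h : R -> R) :
  bounded01 g -> bounded01 h -> bounded01 (fun x => g x * h x).
Proof.
  intros [M HM] [N HN]; exists (M * N); intros x Hx; rewrite Rabs_mult.
  apply Rmult_le_compat; auto using Rabs_pos.
Qed.

Lemma bounded01_pow (g : R -> R) (n : nat) :
  bounded01 g -> bounded01 (fun x => g x ^ n).
Proof.
  intros Hg; induction n as [|n IH]; simpl;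
    [apply bounded01_const | exact (bounded01_mult g _ Hg IH)].
Qed.

Lemma bounded01_between (g h : R -> R) :
  bounded01 h -> (forall x, 0 < x <= 1 -> 0 <= g x <= h x) -> bounded01 g.
Proof.
  intros [M HM] H; exists M; intros x Hx; specialize (H x Hx).
  generalize (HM x Hx) (Rle_abs (h x)); rewrite (Rabs_pos_eq (g x)); lra.
Qed.

Lemma bounded01_ext (g h : R -> R) :
  (forall x, 0 < x <= 1 -> g x = h x) -> bounded01 g -> bounded01 h.
Proof.
  intros E [M HM]; exists M; intros x Hx; rewrite <- E; auto.
Qed.

Ltac bounded01 :=
  repeat first [ assumption | apply bounded01_const | exact bounded01_id
    | lazymatch goal with
      | |- bounded01 (fun x => @?g x + @?h x) => apply (bounded01_plus g h)
      | |- bounded01 (fun x => @?g x * @?h x) => apply (bounded01_mult g h)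
      | |- bounded01 (fun x => @?g x ^ ?n) => apply (bounded01_pow g n)
      end ].

(* [h x = c1 x + c2 x^2 + c3 x^3 + O(x^4)] as [x -> 0+]. *)
Definition expansion3 (h : R -> R) (c1 c2 c3 : R) : Prop :=
  bounded01 (fun x => (h x - (c1 * x + c2 * x ^ 2 + c3 * x ^ 3)) / x ^ 4).

Lemma bounded01_div_zero (c : R) (g : R -> R) :
  bounded01 g -> bounded01 (fun x => c / x + g x) -> c = 0.
Proof.
  intros [N HN] [M HM].
  destruct (Req_dec c 0) as [E | Hc]; [exact E | exfalso].
  assert (Hp : 0 < Rabs c) by now apply Rabs_pos_lt.
  assert (HMN : 0 <= M + N).
  { generalize (HM 1 ltac:(lra)) (HN 1 ltac:(lra))
      (Rabs_pos (c / 1 + g 1)) (Rabs_pos (g 1)); lra. }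
  (* At this point |c / x| = |c| + M + N + 1, which exceeds the bound M + N; and x <= 1 because M +
     N >= 0. *)
  set (x := Rabs c / (Rabs c + M + N + 1)).
  assert (Hx : 0 < x <= 1).
  { unfold x; split.
    - apply Rdiv_lt_0_compat; lra.
    - apply Rle_div_l; lra. }
  assert (E : Rabs (c / x) = Rabs c + M + N + 1).
  { unfold Rdiv; rewrite Rabs_mult, Rabs_inv, (Rabs_pos_eq x) by lra.
    unfold x; field; lra. }
  generalize (HM x Hx) (HN x Hx) (Rabs_triang (c / x + g x) (- g x)).
  rewrite Rabs_Ropp; replace (c / x + g x + - g x) with (c / x) by ring; lra.
Qed.

(** Subtracting the two remainders leaves a bounded combination of x^-3, x^-2 and x^-1. Multiplying
    by x^2, then x, then 1 isolates one pole 1 / x at a time, so the coefficients vanish in turn. *)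
Lemma expansion3_unique (h : R -> R) (c1 c2 c3 d1 d2 d3 : R) :
  expansion3 h c1 c2 c3 -> expansion3 h d1 d2 d3 ->
  c1 = d1 /\ c2 = d2 /\ c3 = d3.
Proof.
  intros Hc Hd.
  assert (H : bounded01 (fun x =>
    (d1 - c1) / x ^ 3 + (d2 - c2) / x ^ 2 + (d3 - c3) / x)).
  { eapply bounded01_ext;
      [| apply bounded01_plus;
         [exact Hc | apply (bounded01_mult (fun _ => -1)); [apply bounded01_const | exact Hd]]].
    intros x Hx; simpl; field; lra. }
  assert (E1 : d1 - c1 = 0).
  { apply (bounded01_div_zero _ (fun x => (d2 - c2) + (d3 - c3) * x)); [bounded01 |].
    eapply bounded01_ext; [| apply (bounded01_mult (fun x => x ^ 2)); [| exact H]; bounded01].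
    intros x Hx; simpl; field; lra. }
  rewrite E1 in H.
  assert (E2 : d2 - c2 = 0).
  { apply (bounded01_div_zero _ (fun x => d3 - c3)); [bounded01 |].
    eapply bounded01_ext; [| apply (bounded01_mult (fun x => x)); [| exact H]; bounded01].
    intros x Hx; simpl; field; lra. }
  rewrite E2 in H.
  assert (E3 : d3 - c3 = 0).
  { apply (bounded01_div_zero _ (fun x => 0)); [bounded01 |].
    eapply bounded01_ext; [| exact H].
    intros x Hx; simpl; field; lra. }
  lra.
Qed.

(** Since u = x v with v bounded, cutting the logarithm series after the cubic term costs an error
    between 0 and u^4 / 4, which is O(x^4). What remains is the expansion of a cubic polynomial in
    u. *)
Lemma expansion3_ln (u : R -> R) (c1 c2 c3 : R) :
  (forall x, 0 < x <= 1 -> 0 <= u x) -> expansion3 u c1 c2 c3 ->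
  expansion3 (fun x => ln (1 + u x))
    c1 (c2 - c1 ^ 2 / 2) (c3 - c1 * c2 + c1 ^ 3 / 3).
Proof.
  intros Hu He; unfold expansion3 in *.
  set (r := fun x => (u x - (c1 * x + c2 * x ^ 2 + c3 * x ^ 3)) / x ^ 4) in *.
  set (v := fun x => c1 + c2 * x + c3 * x ^ 2 + r x * x ^ 3).
  assert (Hv : bounded01 v) by (unfold v; bounded01).
  assert (Euv : forall x, 0 < x <= 1 -> u x = x * v x).
  { intros x Hx; unfold v, r; field; lra. }
  set (rho := fun x =>
    (u x - u x ^ 2 / 2 + u x ^ 3 / 3 - ln (1 + u x)) / x ^ 4).
  assert (Hrho : bounded01 rho).
  { apply (bounded01_between _ (fun x => / 4 * v x ^ 4)); [bounded01 |].
    intros x Hx; unfold rho.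
    assert (Hx4 : 0 < x ^ 4) by (apply pow_lt; lra).
    generalize (ln_1p_bounds (u x) (Hu x Hx)); intros Hb.
    split; [apply Rdiv_le_0_compat; lra |].
    apply Rle_div_l; [lra |].
    replace (/ 4 * v x ^ 4 * x ^ 4) with (u x ^ 4 / 4)
      by (rewrite (Euv x Hx); field).
    lra. }
  (* With [w = (v - c1) / x], expand [u = x (c1 + x w)], [w = c2 + x s]. *)
  set (s := fun x => c3 + r x * x).
  set (w := fun x => c2 + x * s x).
  assert (Hs : bounded01 s) by (unfold s; bounded01).
  assert (Hw : bounded01 w) by (unfold w; bounded01).
  (* The four summands are the remainders, divided by x^4, of u, of - u^2 / 2, of u^3 / 3 and of the
     truncated logarithm. *)
  apply (bounded01_ext (fun x =>
     r x
     + (-1 / 2) * (w x ^ 2 + 2 * c1 * s x)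
     + (/ 3) * (3 * c1 ^ 2 * w x + 3 * c1 * x * w x ^ 2 + x ^ 2 * w x ^ 3)
     + -1 * rho x)).
  2: { bounded01. }
  intros x Hx; unfold rho.
  rewrite (Euv x Hx).
  replace (v x) with (c1 + x * w x) by (unfold w, s, v; ring).
  replace (r x) with ((x * (c1 + x * w x) - (c1 * x + c2 * x ^ 2 + c3 * x ^ 3)) / x ^ 4)
    by (unfold w, s; field; lra).
  unfold w; field; lra.
Qed.

(** * Canonical products on the real axis in the parameters y_k = -1 / x_k; y_k = 0 gives the factor
    1 *)

Fixpoint real_partial_product (y : nat -> R) (m : nat) (x : R) : R :=
  match m with
  | O => 1
  | S m' => real_partial_product y m' x * ((1 + y m' * x) * exp (- (y m' * x)))
  end.

Lemma real_partial_product_0 (y : nat -> R) (m : nat) :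
  real_partial_product y m 0 = 1.
Proof.
  induction m as [|m IH]; simpl; [reflexivity |].
  rewrite IH, Rmult_0_r, Ropp_0, exp_0; ring.
Qed.

Lemma real_partial_product_root (y : nat -> R) (k m : nat) :
  y k <> 0 -> (k < m)%nat -> real_partial_product y m (- / y k) = 0.
Proof.
  intros Hk; induction 1 as [|m _ IH]; simpl.
  - replace (1 + y k * - / y k) with 0 by (field; exact Hk); ring.
  - rewrite IH; ring.
Qed.

(** All factors are positive here, so logarithms are available. The shift to [S m] is due to
    [sum_n], which includes the index m. *)
Lemma real_partial_product_exp (y : nat -> R) (x : R) :
  (forall k, 0 <= y k) -> 0 <= x -> forall m,
  real_partial_product y (S m) x
  = exp (sum_n (fun k => ln (1 + y k * x) - y k * x) m).
Proof.
  intros Hy Hx.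
  assert (step : forall k,
    (1 + y k * x) * exp (- (y k * x)) = exp (ln (1 + y k * x) - y k * x)).
  { intros k; unfold Rminus; rewrite exp_plus, exp_ln; [reflexivity |].
    generalize (Rmult_le_pos _ _ (Hy k) Hx); lra. }
  induction m as [|m IH].
  - rewrite sum_O, <- step; simpl; ring.
  - change (real_partial_product y (S (S m)) x)
      with (real_partial_product y (S m) x
            * ((1 + y (S m) * x) * exp (- (y (S m) * x)))).
    rewrite IH, sum_Sn, step; unfold plus; simpl; now rewrite exp_plus.
Qed.

(** * Real series: comparison and remainder estimates *)

Lemma is_series_nonneg_term_le (u : nat -> R) (l : R) (k : nat) :
  (forall j, 0 <= u j) -> is_series u l -> u k <= l.
Proof.
  intros Hu Hs.
  assert (mono : forall j, u k <= sum_n u (j + k)).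
  { induction j as [|j IH]; simpl.
    - destruct k as [|k]; [rewrite sum_O; lra |].
      rewrite sum_Sn; unfold plus; simpl.
      enough (0 <= sum_n u k) by lra.
      clear - Hu; induction k as [|k IH];
        [rewrite sum_O; apply Hu | rewrite sum_Sn; unfold plus; simpl].
      generalize (Hu (S k)); lra.
    - rewrite sum_Sn; unfold plus; simpl.
      generalize (Hu (S (j + k))); lra. }
  apply (is_lim_seq_le (fun _ => u k) (fun j => sum_n u (j + k)) (u k) l mono).
  - apply is_lim_seq_const.
  - now apply (is_lim_seq_incr_n (sum_n u) k l).
Qed.

Lemma is_series_le (u v : nat -> R) (l l' : R) :
  (forall k, u k <= v k) -> is_series u l -> is_series v l' -> l <= l'.
Proof.
  intros H Hu Hv.
  apply (is_lim_seq_le (sum_n u) (sum_n v) l l'); [| exact Hu | exact Hv].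
  intros m; apply sum_n_m_le, H.
Qed.

Lemma is_series_lincomb (u v w : nat -> R) (lu lv lw p q r : R) :
  is_series u lu -> is_series v lv -> is_series w lw ->
  is_series (fun k => p * u k + q * v k + r * w k) (p * lu + q * lv + r * lw).
Proof.
  intros Hu Hv Hw.
  apply (is_series_plus (fun k => p * u k + q * v k) (fun k => r * w k)).
  - apply (is_series_plus (fun k => p * u k) (fun k => q * v k)).
    + now apply (is_series_scal p u).
    + now apply (is_series_scal q v).
  - now apply (is_series_scal r w).
Qed.

(** For k >= 4 and 0 <= x <= 1 one has x^k <= x^4, so the tail is at most x^4 times the sum of the
    coefficients. *)
Lemma power_series_cubic_remainder (a : nat -> R) (x l l1 : R) :
  (forall k, 0 <= a k) -> 0 <= x <= 1 ->
  is_series (fun k => a k * x ^ k) l -> is_series a l1 ->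
  0 <= l - (a 0%nat + a 1%nat * x + a 2%nat * x ^ 2 + a 3%nat * x ^ 3)
    <= x ^ 4 * l1.
Proof.
  intros Ha Hx Hl Hl1.
  set (p := a 0%nat + a 1%nat * x + a 2%nat * x ^ 2 + a 3%nat * x ^ 3).
  assert (Hxk : forall k, 0 <= x ^ k) by (intros; apply pow_le; lra).
  (* Starting at index 3 makes the base case exactly the cubic polynomial [p]. *)
  assert (B : forall j, 0 <= sum_n (fun k => a k * x ^ k) (j + 3) - p
                          <= x ^ 4 * sum_n a (j + 3)).
  { induction j as [|j IH].
    - replace (sum_n (fun k => a k * x ^ k) (0 + 3)) with p.
      + replace (sum_n a (0 + 3)) with (a 0%nat + a 1%nat + a 2%nat + a 3%nat).
        * generalize (Ha 0%nat) (Ha 1%nat) (Ha 2%nat) (Ha 3%nat); intros.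
          split; [lra |]; rewrite Rminus_diag.
          apply Rmult_le_pos; [apply Hxk | lra].
        * change (0 + 3)%nat with 3%nat; now rewrite !sum_Sn, sum_O.
      + change (0 + 3)%nat with 3%nat; rewrite !sum_Sn, sum_O.
        unfold plus, p; simpl; ring.
    - change (S j + 3)%nat with (S (j + 3)); rewrite !sum_Sn; unfold plus; simpl AbelianMonoid.plus.
      assert (Hs : x ^ S (j + 3) <= x ^ 4).
      { replace (S (j + 3)) with (j + 4)%nat by lia; rewrite pow_add.
        assert (x ^ j <= 1) by (rewrite <- (pow1 j); apply pow_incr; lra).
        generalize (Hxk 4%nat); nra. }
      generalize (Ha (S (j + 3))) (Hxk (S (j + 3))); simpl in *; intros; nra. }
  split.
  - enough (p <= l) by lra.
    apply (is_lim_seq_le (fun _ => p) (fun j => sum_n (fun k => a k * x ^ k) (j + 3)) p l).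
    + intros j; generalize (B j); lra.
    + apply is_lim_seq_const.
    + now apply (is_lim_seq_incr_n (sum_n _) 3 l).
  - enough (l <= p + x ^ 4 * l1) by lra.
    apply (is_lim_seq_le (fun j => sum_n (fun k => a k * x ^ k) (j + 3))
             (fun j => p + x ^ 4 * sum_n a (j + 3)) l (p + x ^ 4 * l1)).
    + intros j; generalize (B j); lra.
    + now apply (is_lim_seq_incr_n (sum_n (fun k => a k * x ^ k)) 3 l).
    + apply (is_lim_seq_plus' (fun _ => p) (fun j => x ^ 4 * sum_n a (j + 3))).
      * apply is_lim_seq_const.
      * apply (is_lim_seq_scal_l (fun j => sum_n a (j + 3)) (x ^ 4) l1).
        now apply (is_lim_seq_incr_n (sum_n a) 3 l1).
Qed.

(** * Growth at infinity: constraints on alpha and beta *)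

Lemma gaussian_factor_trivial (alpha beta : R) :
  0 <= alpha -> (forall x, 0 <= x -> 0 <= - alpha * x ^ 2 + beta * x) ->
  alpha = 0.
Proof.
  intros Ha H.
  destruct (Rle_lt_or_eq_dec _ _ Ha) as [Hp | E]; [exfalso | now symmetry].
  (* Here alpha x = |beta| + 1, so the exponent x (beta - alpha x) is at most - x < 0. *)
  set (x := (Rabs beta + 1) / alpha).
  assert (Hx : 0 < x).
  { apply Rdiv_lt_0_compat; [generalize (Rabs_pos beta); lra | exact Hp]. }
  assert (E : alpha * x = Rabs beta + 1) by (unfold x; field; lra).
  specialize (H x (Rlt_le _ _ Hx)).
  replace (- alpha * x ^ 2 + beta * x) with (x * (beta - alpha * x)) in H by ring.
  rewrite E in H; generalize (Rle_abs beta); nra.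
Qed.

(* Letting x -> oo: each log(1 + y_k x) is o(x). *)
Lemma root_sum_le (y : nat -> R) (beta : R) (m : nat) :
  (forall k, 0 <= y k) ->
  (forall x, 0 <= x ->
     0 <= beta * x + sum_n (fun k => ln (1 + y k * x) - y k * x) m) ->
  sum_n y m <= beta.
Proof.
  intros Hy H; set (s := sum_n y m).
  apply Rnot_lt_le; intros Hlt.
  assert (Hs : 0 <= s).
  { unfold s; clear - Hy; induction m as [|m IH];
      [rewrite sum_O; apply Hy |].
    rewrite sum_Sn; unfold plus; simpl; generalize (Hy (S m)); lra. }
  (* Small enough to keep (1 - e) s > beta: the gap [d] below equals (s - beta) (s + 2) / (2 (s +
     1)). *)
  set (e := (s - beta) / (2 * (s + 1))).
  assert (He : 0 < e) by (apply Rdiv_lt_0_compat; lra).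
  (* This constant comes from ln v <= v - 1 at v = e (1 + t): the logarithm is bounded by a line of
     slope e. *)
  set (K := e - 1 - ln e).
  assert (Hln : forall t, 0 <= t -> ln (1 + t) <= e * t + K).
  { intros t Ht.
    generalize (ln_le_minus_1 (e * (1 + t)) ltac:(nra)).
    rewrite ln_mult by lra; unfold K; lra. }
  assert (Hsum : forall x, 0 <= x ->
    sum_n (fun k => ln (1 + y k * x) - y k * x) m
    <= - (1 - e) * x * s + (INR m + 1) * K).
  (* [e] and [K] depend on m through [s]; they are frozen as constants before the induction on m. *)
  { intros x Hx; unfold s; clearbody K; clearbody e; clear - Hy Hln Hx.
    assert (T : forall k, ln (1 + y k * x) - y k * x <= - (1 - e) * x * y k + K).
    { intros k; generalize (Hln (y k * x) (Rmult_le_pos _ _ (Hy k) Hx)); lra. }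
    induction m as [|m IH].
    - rewrite !sum_O; simpl; generalize (T 0%nat); lra.
    - rewrite !sum_Sn, S_INR; unfold plus; simpl; generalize (T (S m)); lra. }
  set (d := (1 - e) * s - beta).
  assert (Hd : 0 < d).
  { unfold d, e.
    replace ((1 - (s - beta) / (2 * (s + 1))) * s - beta)
      with ((s - beta) * (s + 2) / (2 * (s + 1))) by (field; lra).
    apply Rdiv_lt_0_compat; nra. }
  (* The expression in [H] is at most - d x + (m + 1) K, which is negative at this x. *)
  set (x := (Rabs ((INR m + 1) * K) + 1) / d).
  assert (Hx : 0 < x).
  { apply Rdiv_lt_0_compat; [generalize (Rabs_pos ((INR m + 1) * K)); lra | exact Hd]. }
  assert (E : d * x = Rabs ((INR m + 1) * K) + 1) by (unfold x; field; lra).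
  generalize (H x ltac:(lra)) (Hsum x ltac:(lra)) (Rle_abs ((INR m + 1) * K)).
  unfold d in E; lra.
Qed.

(** * Power sums of the y_k and the expansion of ln P *)

Lemma is_series_pow_succ (y : nat -> R) (b : R) (j : nat) :
  (forall k, 0 <= y k <= b) -> ex_series y -> ex_series (fun k => y k ^ S j).
Proof.
  intros Hy Hs; induction j as [|j IH].
  - apply ex_series_ext with y; [intros; simpl; ring | exact Hs].
  - apply (ex_series_le (K := R_AbsRing) (V := R_CompleteNormedModule)
             _ (fun k => b * y k ^ S j)).
    + intros k; unfold norm; simpl; unfold abs; simpl.
      destruct (Hy k) as [H0 H1].
      assert (0 <= y k * y k ^ j).
      { apply Rmult_le_pos; [exact H0 | now apply pow_le]. }
      rewrite Rabs_pos_eq by nra; nra.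
    + now apply (ex_series_scal (V := R_NormedModule) b (fun k => y k ^ S j)).
Qed.

(** The bounds on ln (1 + y_k x) are summed over k. The convergence factors exp (- y_k x) cancel the
    linear terms, hence the coefficient 0, and the total error lies between 0 and x^4 S_4 / 4. *)
Lemma expansion3_ln_product (y : nat -> R) (P : R -> R) (S2 S3 S4 : R) :
  (forall k, 0 <= y k) ->
  (forall x, 0 < x <= 1 -> 0 < P x) ->
  (forall x, 0 < x <= 1 ->
     is_lim_seq (fun m => real_partial_product y m x) (P x)) ->
  is_series (fun k => y k ^ 2) S2 -> is_series (fun k => y k ^ 3) S3 ->
  is_series (fun k => y k ^ 4) S4 ->
  expansion3 (fun x => ln (P x)) 0 (- S2 / 2) (S3 / 3).
Proof.
  intros Hy HP Hlim H2 H3 H4.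
  assert (HS : forall x, 0 < x <= 1 ->
    is_series (fun k => ln (1 + y k * x) - y k * x) (ln (P x))).
  { intros x Hx.
    apply (is_lim_seq_ext (fun m => ln (real_partial_product y (S m) x)) _ (ln (P x))).
    { intros m; rewrite (real_partial_product_exp y x Hy) by lra; apply ln_exp. }
    apply (is_lim_seq_continuous ln (fun m => real_partial_product y (S m) x)).
    - apply derivable_continuous_pt; exists (/ P x).
      apply derivable_pt_lim_ln, HP, Hx.
    - apply (is_lim_seq_incr_1 (fun m => real_partial_product y m x)), Hlim, Hx. }
  unfold expansion3.
  (* The sign is flipped to make the remainder nonnegative, as [bounded01_between] requires. *)
  apply (bounded01_ext (fun x => -1 *
     (((- S2 / 2) * x ^ 2 + (S3 / 3) * x ^ 3 - ln (P x)) / x ^ 4))).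
  { intros x Hx; field; lra. }
  apply bounded01_mult; [apply bounded01_const |].
  apply (bounded01_between _ (fun _ => S4 / 4)); [apply bounded01_const |].
  intros x Hx.
  assert (Hx4 : 0 < x ^ 4) by (apply pow_lt; lra).
  generalize (is_series_lincomb _ _ _ _ _ _ (- x ^ 2 / 2) (x ^ 3 / 3) 0 H2 H3 H4).
  generalize (is_series_lincomb _ _ _ _ _ _ (- x ^ 2 / 2) (x ^ 3 / 3) (- x ^ 4 / 4) H2 H3 H4).
  intros Hlo Hhi.
  assert (B : forall k, y k * x - (y k * x) ^ 2 / 2 + (y k * x) ^ 3 / 3 - (y k * x) ^ 4 / 4
    <= ln (1 + y k * x) <= y k * x - (y k * x) ^ 2 / 2 + (y k * x) ^ 3 / 3).
  { intros k; apply ln_1p_bounds, Rmult_le_pos; [apply Hy | lra]. }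
  assert (L := fun H => is_series_le _ _ _ _ H Hlo (HS x Hx)).
  assert (U := fun H => is_series_le _ _ _ _ H (HS x Hx) Hhi).
  specialize (L ltac:(intros k; generalize (B k); rewrite !Rpow_mult_distr; lra)).
  specialize (U ltac:(intros k; generalize (B k); rewrite !Rpow_mult_distr; lra)).
  split; [apply Rdiv_le_0_compat; lra |].
  apply Rle_div_l; lra.
Qed.

(** * Signs of the y_k and incompatible power sums *)

Lemma no_positive_root_parameter (F : R -> R) (y : nat -> R) :
  (forall x, 0 <= x -> 0 < F x) ->
  (forall k, y k <> 0 -> F (- / y k) = 0) -> forall k, 0 <= y k.
Proof.
  intros HF Hroot k; apply Rnot_lt_le; intros Hk.
  assert (Hi : / y k < 0) by now apply Rinv_lt_0_compat.
  generalize (HF (- / y k) ltac:(lra)); rewrite (Hroot k); lra.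
Qed.

(** The bound y_k < A_2 / A_1 encodes that no zero -1 / y_k lies in [-a_1 / a_2, 0], and the last
    inequality is q_2 <= q_3 with denominators cleared. *)
Lemma power_sums_contradiction (y : nat -> R) (A1 A2 A3 S1 S2 S3 : R) :
  0 < A1 -> 0 < A2 ->
  (forall k, 0 <= y k) -> (forall k, y k < A2 / A1) ->
  is_series y S1 -> is_series (fun k => y k ^ 2) S2 ->
  is_series (fun k => y k ^ 3) S3 ->
  S1 <= A1 -> S2 = A1 ^ 2 - 2 * A2 -> S3 = A1 ^ 3 - 3 * A1 * A2 + 3 * A3 ->
  A1 ^ 3 * A3 <= A2 ^ 3 -> False.
Proof.
  intros HA1 HA2 Hy HyB H1 H2 H3 HS1 E2 E3 Hq.
  set (B := A2 / A1) in *.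
  assert (EB : B * A1 = A2) by (unfold B; field; lra).
  assert (HB : 0 < B) by now apply Rdiv_lt_0_compat.
  assert (HS2 : 0 <= S2).
  { apply Rle_trans with (y 0%nat ^ 2); [apply pow2_ge_0 |].
    apply (is_series_nonneg_term_le (fun k => y k ^ 2)); [| exact H2].
    intros; apply pow2_ge_0. }
  (* Cauchy-Schwarz, from [0 <= sum_k y_k (y_k - t)^2] at [t = S2 / A1]. *)
  assert (CS : S2 ^ 2 <= A1 * S3).
  { set (t := S2 / A1).
    assert (Et : t * A1 = S2) by (unfold t; field; lra).
    assert (Hnn : 0 <= t ^ 2 * S1 + (-2 * t) * S2 + 1 * S3).
    { assert (Hterm : forall j, 0 <= t ^ 2 * y j + (-2 * t) * y j ^ 2 + 1 * y j ^ 3).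
      { intros j.
        replace (t ^ 2 * y j + (-2 * t) * y j ^ 2 + 1 * y j ^ 3)
          with (y j * (y j - t) ^ 2) by ring.
        apply Rmult_le_pos; [apply Hy | apply pow2_ge_0]. }
      eapply Rle_trans; [apply (Hterm 0%nat) |].
      apply (is_series_nonneg_term_le
        (fun j => t ^ 2 * y j + (-2 * t) * y j ^ 2 + 1 * y j ^ 3) _ 0 Hterm).
      now apply is_series_lincomb. }
    assert (t ^ 2 * S1 <= t ^ 2 * A1)
      by (apply Rmult_le_compat_l; [apply pow2_ge_0 | exact HS1]).
    assert (0 <= A1 * (t ^ 2 * A1 + (-2 * t) * S2 + 1 * S3))
      by (apply Rmult_le_pos; lra).
    replace (A1 * (t ^ 2 * A1 + (-2 * t) * S2 + 1 * S3))
      with ((t * A1) ^ 2 - 2 * (t * A1) * S2 + A1 * S3) in H0 by ring.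
    rewrite Et in H0; lra. }
  (* The terms y_k (B - y_k) are nonnegative with sum B S_1 - S_2 <= A_2 - S_2. Were this <= 0, each
     term would vanish; as y_k < B, all y_k would be 0, making S_2 = 0 < A_2. *)
  assert (HS2A : S2 < A2).
  { apply Rnot_le_lt; intros Hle.
    assert (Hz : forall k, y k * (B - y k) <= 0).
    { intros k; apply Rle_trans with (B * S1 + (-1) * S2 + 0 * S3).
      - replace (y k * (B - y k)) with (B * y k + (-1) * y k ^ 2 + 0 * y k ^ 3) by ring.
        apply (is_series_nonneg_term_le
          (fun j => B * y j + (-1) * y j ^ 2 + 0 * y j ^ 3)).
        + intros j; generalize (Hy j) (HyB j); intros; nra.
        + now apply is_series_lincomb.
      - assert (B * S1 <= B * A1) by (apply Rmult_le_compat_l; lra); lra. }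
    assert (Hy0 : forall k, y k = 0).
    { intros k; generalize (Hy k) (HyB k) (Hz k); intros; nra. }
    assert (S2 <= 0 * S2 + 0 * S2 + 0 * S2); [| lra].
    apply (is_series_le (fun k => y k ^ 2)
             (fun k => 0 * y k ^ 2 + 0 * y k ^ 2 + 0 * y k ^ 2)); [| exact H2 |].
    - intros k; rewrite Hy0; simpl; lra.
    - now apply is_series_lincomb. }
  assert (HA : A1 ^ 2 < 3 * A2) by lra.
  (* Cauchy-Schwarz times A_1^2, plus three times the inequality [Hq], factors as A_2 times this
     product. Its first factor is positive because S_2 >= 0 means A_1^2 >= 2 A_2. *)
  assert (K : 0 <= (A1 ^ 2 - A2) * (A1 ^ 2 - 3 * A2)).
  { assert (L : 0 <= A1 ^ 2 * (A1 * S3 - S2 ^ 2))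
      by (apply Rmult_le_pos; [apply pow2_ge_0 | lra]).
    rewrite E2, E3 in L.
    assert (L' : 0 <= A2 * ((A1 ^ 2 - A2) * (A1 ^ 2 - 3 * A2))).
    { replace (A2 * ((A1 ^ 2 - A2) * (A1 ^ 2 - 3 * A2)))
        with (A1 ^ 2 * (A1 * (A1 ^ 3 - 3 * A1 * A2 + 3 * A3) - (A1 ^ 2 - 2 * A2) ^ 2)
              + 3 * (A2 ^ 3 - A1 ^ 3 * A3)) by ring.
      lra. }
    apply Rmult_le_reg_l with A2; lra. }
  assert (0 < (A1 ^ 2 - A2) * (3 * A2 - A1 ^ 2)) by (apply Rmult_lt_0_compat; lra).
  lra.
Qed.

(** * The argument by contradiction on the real axis *)

Lemma positive_real_product_absurd (a : nat -> R) (F P : R -> R) (y : nat -> R)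
    (c alpha beta : R) (n : nat) :
  (forall k, 0 < a k) ->
  (forall x, is_series (fun k => a k * x ^ k) (F x)) ->
  second_quotient a 2 <= second_quotient a 3 ->
  0 <= alpha ->
  (forall x, is_lim_seq (fun m => real_partial_product y m x) (P x)) ->
  (forall x, F x = c * x ^ n * exp (- alpha * x ^ 2 + beta * x) * P x) ->
  (forall z, - (a 1%nat / a 2%nat) <= z <= 0 -> 0 < F z) -> False.
Proof.
  intros Ha HF Hq Halpha HP EF Hpos.
  assert (Ha' : forall k, 0 <= a k) by (intros; now apply Rlt_le).
  assert (Hrem : forall x, 0 <= x <= 1 ->
    0 <= F x - (a 0%nat + a 1%nat * x + a 2%nat * x ^ 2 + a 3%nat * x ^ 3)
      <= x ^ 4 * F 1).
  { intros x Hx; apply power_series_cubic_remainder; auto.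
    apply is_series_ext with (2 := HF 1); intros k; rewrite pow1; apply Rmult_1_r. }
  assert (HFa0 : forall x, 0 <= x -> a 0%nat <= F x).
  { intros x Hx; replace (a 0%nat) with (a 0%nat * x ^ 0) by (simpl; ring).
    apply (is_series_nonneg_term_le (fun k => a k * x ^ k) (F x)); [| apply HF].
    intros j; apply Rmult_le_pos; [auto | now apply pow_le]. }
  assert (HFpos : forall x, 0 <= x -> 0 < F x).
  { intros x Hx; generalize (HFa0 x Hx) (Ha 0%nat); lra. }
  assert (P0 : P 0 = 1).
  { assert (E : Finite (P 0) = Finite 1); [| now injection E].
    rewrite <- (is_lim_seq_unique _ _ (HP 0)).
    rewrite <- (Lim_seq_const 1); apply Lim_seq_ext.
    apply real_partial_product_0. }
  assert (F0 : F 0 = a 0%nat).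
  { generalize (Hrem 0 ltac:(lra)); simpl; lra. }
  destruct n as [|n].
  (* A factor x^n with n > 0 would make F vanish at 0. *)
  2: { generalize (HFpos 0 ltac:(lra)); rewrite EF; simpl; lra. }
  assert (Ec : c = a 0%nat).
  { rewrite <- F0, EF, P0.
    replace (- alpha * 0 ^ 2 + beta * 0) with 0 by ring.
    rewrite exp_0; simpl; ring. }
  (* The partial products vanish at this point from index k + 1 on, hence so does their limit. *)
  assert (Hroot : forall k, y k <> 0 -> F (- / y k) = 0).
  { intros k Hk; rewrite EF.
    assert (E : P (- / y k) = 0); [| rewrite E; ring].
    assert (E : Finite (P (- / y k)) = Finite 0); [| now injection E].
    rewrite <- (is_lim_seq_unique _ _ (HP (- / y k))).
    rewrite <- (Lim_seq_const 0); apply Lim_seq_ext_loc.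
    exists (S k); intros m Hm; now apply real_partial_product_root. }
  assert (Hy : forall k, 0 <= y k) by exact (no_positive_root_parameter F y HFpos Hroot).
  assert (HyB : forall k, y k < a 2%nat / a 1%nat).
  { intros k; apply Rnot_le_lt; intros Hk.
    assert (HB : 0 < a 2%nat / a 1%nat) by now apply Rdiv_lt_0_compat.
    assert (Hi : 0 < / y k) by (apply Rinv_0_lt_compat; lra).
    assert (Hle : / y k <= a 1%nat / a 2%nat).
    { replace (a 1%nat / a 2%nat) with (/ (a 2%nat / a 1%nat)).
      - now apply Rinv_le_contravar.
      - field; split; apply Rgt_not_eq, Ha. }
    generalize (Hpos (- / y k) ltac:(lra)); rewrite Hroot by lra; lra. }
  set (e := fun x k => ln (1 + y k * x) - y k * x).
  assert (He : forall x k, 0 <= x -> e x k <= 0).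
  { intros x k Hx; unfold e.
    assert (0 <= y k * x) by (apply Rmult_le_pos; auto).
    generalize (ln_le_minus_1 (1 + y k * x) ltac:(lra)); lra. }
  (* Each factor is at most 1 for x >= 0, so the partial products decrease to P. *)
  assert (HPle : forall x m, 0 <= x -> P x <= exp (sum_n (e x) m)).
  { intros x m Hx.
    apply (is_lim_seq_decr_compare (fun m => exp (sum_n (e x) m))).
    - apply (is_lim_seq_ext (fun m => real_partial_product y (S m) x)).
      + intros j; now apply real_partial_product_exp.
      + apply (is_lim_seq_incr_1 (fun m => real_partial_product y m x)), HP.
    - intros j; rewrite sum_Sn; unfold plus; simpl.
      apply Rnot_lt_le; intros Hlt; apply exp_lt_inv in Hlt.
      generalize (He x (S j) Hx); lra. }
  (* Replacing P by a partial product in a_0 <= F x and dividing by a_0 leaves an exponential that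
     is at least 1. *)
  assert (Hexp : forall x m, 0 <= x ->
    0 <= - alpha * x ^ 2 + beta * x + sum_n (e x) m).
  { intros x m Hx.
    apply Rnot_lt_le; intros Hlt; apply exp_increasing in Hlt.
    rewrite exp_0, exp_plus in Hlt.
    generalize (HFa0 x Hx) (HPle x m Hx) (Ha 0%nat)
      (exp_pos (- alpha * x ^ 2 + beta * x)).
    rewrite EF, Ec; simpl pow at 1; intros H1 H2 H3 H4.
    set (g := exp (- alpha * x ^ 2 + beta * x)) in *.
    assert (g * P x <= g * exp (sum_n (e x) m)) by (apply Rmult_le_compat_l; lra).
    nra. }
  assert (Ealpha : alpha = 0).
  { apply (gaussian_factor_trivial alpha beta Halpha).
    intros x Hx; generalize (Hexp x 0%nat Hx) (He x 0%nat Hx); rewrite sum_O; lra. }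
  subst alpha.
  assert (Hsum : forall m, sum_n y m <= beta).
  { intros m; apply root_sum_le; [exact Hy |].
    intros x Hx; generalize (Hexp x m Hx); unfold e; lra. }
  assert (Hs1 : ex_series y).
  { destruct (ex_finite_lim_seq_incr (sum_n y) beta) as [l Hl].
    - intros m; rewrite sum_Sn; unfold plus; simpl; generalize (Hy (S m)); lra.
    - exact Hsum.
    - now exists l. }
  (* The index j stands for exponent j + 1, so S_2, S_3, S_4 come from j = 1, 2, 3. *)
  assert (Hpow : forall j, ex_series (fun k => y k ^ S j)).
  { intros j; apply is_series_pow_succ with (b := a 2%nat / a 1%nat); [| exact Hs1].
    intros k; split; [apply Hy | apply Rlt_le, HyB]. }
  destruct Hs1 as [S1 H1], (Hpow 1%nat) as [S2 H2],
    (Hpow 2%nat) as [S3 H3], (Hpow 3%nat) as [S4 H4].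
  assert (HS1 : S1 <= beta).
  { apply (is_lim_seq_le (sum_n y) (fun _ => beta) S1 beta Hsum H1).
    apply is_lim_seq_const. }
  set (A1 := a 1%nat / a 0%nat); set (A2 := a 2%nat / a 0%nat);
    set (A3 := a 3%nat / a 0%nat).
  generalize (Ha 0%nat) (Ha 1%nat) (Ha 2%nat) (Ha 3%nat); intros a0 a1 a2 a3.
  (* First expansion of ln (F / a_0), from the power series; the form 1 + u with u >= 0 fits
     [expansion3_ln]. *)
  assert (X1 : expansion3 (fun x => ln (1 + (F x / a 0%nat - 1)))
                 A1 (A2 - A1 ^ 2 / 2) (A3 - A1 * A2 + A1 ^ 3 / 3)).
  { apply expansion3_ln.
    - intros x Hx; generalize (HFa0 x ltac:(lra)); intros.
      enough (1 <= F x / a 0%nat) by lra.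
      apply Rle_div_r; lra.
    - apply (bounded01_between _ (fun _ => F 1 / a 0%nat));
        [apply bounded01_const |].
      intros x Hx.
      assert (Hx4 : 0 < x ^ 4) by (apply pow_lt; lra).
      generalize (Hrem x ltac:(lra)).
      set (r := F x - _); intros Hr.
      replace ((F x / a 0%nat - 1 - (A1 * x + A2 * x ^ 2 + A3 * x ^ 3)) / x ^ 4)
        with (r / x ^ 4 / a 0%nat) by (unfold r, A1, A2, A3; field; lra).
      assert (Hr4 : 0 <= r / x ^ 4 <= F 1).
      { split; [apply Rdiv_le_0_compat; lra | apply Rle_div_l; lra]. }
      split; [apply Rdiv_le_0_compat; lra |].
      apply Rmult_le_compat_r; [apply Rlt_le, Rinv_0_lt_compat |]; lra. }
  assert (HPpos : forall x, 0 < x <= 1 -> 0 < P x).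
  { intros x Hx; generalize (HFpos x ltac:(lra)); rewrite EF, Ec; simpl pow at 1.
    generalize (exp_pos (- 0 * x ^ 2 + beta * x)); intros Hg HPx.
    apply Rmult_lt_reg_l with (a 0%nat * exp (- 0 * x ^ 2 + beta * x)).
    - now apply Rmult_lt_0_compat.
    - lra. }
  (* Second expansion of the same function, from the factorization: ln (F / a_0) = beta x + ln P. *)
  assert (X2 : expansion3 (fun x => ln (1 + (F x / a 0%nat - 1)))
                 beta (- S2 / 2) (S3 / 3)).
  { apply (bounded01_ext (fun x =>
      (ln (P x) - (0 * x + (- S2 / 2) * x ^ 2 + (S3 / 3) * x ^ 3)) / x ^ 4)).
    - intros x Hx.
      replace (1 + (F x / a 0%nat - 1)) with (exp (beta * x) * P x).
      + rewrite ln_mult, ln_exp; [field; lra | apply exp_pos | auto].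
      + rewrite EF, Ec; replace (- 0 * x ^ 2 + beta * x) with (beta * x) by ring.
        simpl; field; lra.
    - apply (expansion3_ln_product y P S2 S3 S4); auto. }
  destruct (expansion3_unique _ _ _ _ _ _ _ X1 X2) as [E1 [E2 E3]].
  apply (power_sums_contradiction y A1 A2 A3 S1 S2 S3); try assumption.
  - now apply Rdiv_lt_0_compat.
  - now apply Rdiv_lt_0_compat.
  - intros k; replace (A2 / A1) with (a 2%nat / a 1%nat)
      by (unfold A1, A2; field; lra); apply HyB.
  - lra.
  - lra.
  - lra.
  - unfold second_quotient in Hq; simpl Nat.sub in Hq.
    assert (E : 0 <= (A2 ^ 3 - A1 ^ 3 * A3)); [| lra].
    (* The difference is q_3 - q_2 times a positive quantity. *)
    replace (A2 ^ 3 - A1 ^ 3 * A3) with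
      ((a 2%nat ^ 2 / (a 1%nat * a 3%nat) - a 1%nat ^ 2 / (a 0%nat * a 2%nat))
       * (a 1%nat * a 2%nat * a 3%nat / a 0%nat ^ 3))
      by (unfold A1, A2, A3; field; lra).
    apply Rmult_le_pos; [lra |].
    apply Rdiv_le_0_compat; [| apply pow_lt; lra].
    apply Rmult_le_pos; [apply Rmult_le_pos |]; lra.
Qed.

(** * Restriction of the complex data to the real axis *)

Lemma Cexp_RtoC (t : R) : Cexp (RtoC t) = RtoC (exp t).
Proof.
  unfold Cexp, RtoC; simpl; rewrite cos_0, sin_0; f_equal; ring.
Qed.

Lemma canonical_partial_product_RtoC (x : nat -> R) (m : nat) (t : R) :
  (forall k, (k < m)%nat -> x k <> 0) ->
  canonical_partial_product x m (RtoC t)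
  = RtoC (real_partial_product (fun k => - / x k) m t).
Proof.
  induction m as [|m IH]; intros Hx; [reflexivity |].
  simpl canonical_partial_product; simpl real_partial_product.
  rewrite IH by (intros; apply Hx; lia).
  unfold Cdiv.
  rewrite <- RtoC_inv by (apply Hx; lia).
  rewrite <- RtoC_mult, Cexp_RtoC, <- RtoC_minus, <- !RtoC_mult.
  f_equal; f_equal; f_equal; [ring | f_equal; ring].
Qed.

Lemma filterlim_Re (u : nat -> C) (l : C) :
  filterlim u eventually (locally l) ->
  is_lim_seq (fun m => Re (u m)) (Re l).
Proof.
  intros H; apply (filterlim_comp _ _ _ u Re _ _ _ H).
  destruct l as [l1 l2]; exact (continuous_fst l1 l2).
Qed.

Lemma filterlim_Im (u : nat -> C) (l : C) :
  filterlim u eventually (locally l) ->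
  is_lim_seq (fun m => Im (u m)) (Im l).
Proof.
  intros H; apply (filterlim_comp _ _ _ u Im _ _ _ H).
  destruct l as [l1 l2]; exact (continuous_snd l1 l2).
Qed.

(* [y k = - 1 / x_k]; a finite product is padded with [y k = 0], i.e. zeros at infinity. *)
Lemma canonical_product_RtoC (P : C -> C) :
  canonical_product P -> exists y : nat -> R, forall t : R,
    Im (P (RtoC t)) = 0 /\
    is_lim_seq (fun m => real_partial_product y m t) (Re (P (RtoC t))).
Proof.
  intros [[m [x [Hx HP]]] | [x [Hx [_ HP]]]].
  - set (y := fun k => if Compare_dec.lt_dec k m then - / x k else 0).
    exists y; intros t.
    rewrite HP, canonical_partial_product_RtoC by exact Hx.
    split; [reflexivity |].
    assert (E1 : forall j, (j <= m)%nat ->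
      real_partial_product y j t = real_partial_product (fun k => - / x k) j t).
    { induction j as [|j IH]; intros Hj; simpl; [reflexivity |].
      rewrite IH by lia; unfold y; destruct (Compare_dec.lt_dec j m); [reflexivity | lia]. }
    assert (E2 : forall j, (m <= j)%nat ->
      real_partial_product y j t = real_partial_product (fun k => - / x k) m t).
    { induction 1 as [|j Hj IH]; [now apply E1 |]; simpl.
      rewrite IH; unfold y; destruct (Compare_dec.lt_dec j m); [lia |].
      rewrite Rmult_0_l, Ropp_0, exp_0; ring. }
    apply (is_lim_seq_ext_loc (fun _ => real_partial_product (fun k => - / x k) m t)).
    + exists m; intros j Hj; symmetry; now apply E2.
    + apply is_lim_seq_const.
  - exists (fun k => - / x k); intros t.
    assert (E : forall m, canonical_partial_product x m (RtoC t)
                = RtoC (real_partial_product (fun k => - / x k) m t)).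
    { intros m; apply canonical_partial_product_RtoC; auto. }
    split.
    + assert (L := filterlim_Im _ _ (HP (RtoC t))).
      assert (E0 : Finite (Im (P (RtoC t))) = Finite 0); [| now injection E0].
      rewrite <- (is_lim_seq_unique _ _ L), <- (Lim_seq_const 0).
      apply Lim_seq_ext; intros m; now rewrite E.
    + apply (is_lim_seq_ext (fun m => Re (canonical_partial_product x m (RtoC t)))).
      * intros m; now rewrite E.
      * now apply filterlim_Re.
Qed.

Lemma sum_n_C (u : nat -> C) (m : nat) :
  sum_n (G := C_AbelianMonoid) u m
  = (sum_n (fun k => Re (u k)) m, sum_n (fun k => Im (u k)) m).
Proof.
  induction m as [|m IH].
  - rewrite !sum_O; now destruct (u 0%nat).
  - rewrite !sum_Sn, IH; reflexivity.
Qed.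

Lemma is_pseries_RtoC (a : nat -> R) (x : R) (l : C) :
  is_pseries (K := C_AbsRing) (V := C_NormedModule)
    (fun k => RtoC (a k)) (RtoC x) l ->
  is_series (fun k => a k * x ^ k) (Re l).
Proof.
  intros H; apply filterlim_Re in H.
  apply (is_lim_seq_ext _ (sum_n (fun k => a k * x ^ k)) (Re l)) with (2 := H).
  intros m; rewrite sum_n_C.
  apply (sum_n_ext (fun k => Re (pow_n (K := C_Ring) (RtoC x) k * RtoC (a k))%C)).
  intros k.
  assert (E : pow_n (K := C_Ring) (RtoC x) k = RtoC (x ^ k)).
  { induction k as [|k IH]; [reflexivity |].
    simpl; rewrite IH; unfold mult; simpl; now rewrite <- RtoC_mult. }
  rewrite E, <- RtoC_mult; unfold RtoC; simpl; ring.
Qed.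

Theorem theorem1p3 (a : nat -> R) (f : C -> C)
  (ha : forall k : nat, 0 < a k)
  (hentire : entire f)
  (hseries : forall z : C,
     is_pseries (K := C_AbsRing) (V := C_NormedModule)
       (fun k : nat => RtoC (a k)) z (f z))
  (hq : second_quotient a 2 <= second_quotient a 3)
  (hLP : laguerre_polya f) :
  exists z0 : R,
    - (a 1%nat / a 2%nat) <= z0 <= 0 /\
    Im (f (RtoC z0)) = 0 /\ Re (f (RtoC z0)) <= 0.
Proof.
  destruct hLP as [[_ Him] [c [alpha [beta [n [P [Halpha [HP Ef]]]]]]]].
  destruct (canonical_product_RtoC P HP) as [y Hy].
  (* By excluded middle, either a suitable point exists or f is positive on the whole interval,
     which the real-axis argument refutes. *)
  destruct (Classical_Prop.classic (exists z, - (a 1%nat / a 2%nat) <= z <= 0 /\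
    Re (f (RtoC z)) <= 0)) as [[z [Hz Hle]] | Hno].
  { exists z; auto. }
  exfalso.
  apply (positive_real_product_absurd a (fun x => Re (f (RtoC x)))
           (fun x => Re (P (RtoC x))) y c alpha beta n); auto.
  - intros x; apply is_pseries_RtoC, hseries.
  - intros x; apply Hy.
  - intros x; rewrite Ef.
    (* P is real on the real axis, so the factorization of f becomes an identity between real
       numbers. *)
    assert (EP : P (RtoC x) = RtoC (Re (P (RtoC x)))).
    { destruct (Hy x) as [H0 _]; destruct (P (RtoC x)) as [p1 p2].
      simpl in *; now rewrite H0. }
    rewrite EP, <- !RtoC_pow, <- RtoC_opp, <- !RtoC_mult, <- RtoC_plus, Cexp_RtoC,
      <- !RtoC_mult; reflexivity.
  - intros z Hz; apply Rnot_le_lt; intros Hle; apply Hno; now exists z.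
Qed.
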